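(* Let $X:\mathbb{C}\to\mathbb{C}$ be the linear lattice $X(s)=\mathfrak{c}\,s+\mathfrak{d}$ with $\mathfrak{c},\mathfrak{d}\in\mathbb{C}$, $\mathfrak{c}\neq 0$, and let $X_0(s)=s$. Let $\mathbf{u}\in\mathcal{P}'$ be regular, and assume that there exist polynomials $$\phi(x)=ax^2+bx+c,\qquad \psi(x)=dx+e\qquad (a,b,c,d,e\in\mathbb{C}),$$ not both identically zero, such that $$\boldsymbol{\mathrm{D}}_X(\phi\,\mathbf{u})=\boldsymbol{\mathrm{S}}_X(\psi\,\mathbf{u}).$$ Then there exists a regular functional $\mathbf{v}\in\mathcal{P}'$ such that $\mathbf{v}\sim^{*}\mathbf{u}$ and $$\boldsymbol{\mathrm{D}}_{X_0}(\Phi\,\mathbf{v})=\boldsymbol{\mathrm{S}}_{X_0}(\Psi\,\mathbf{v}),$$ where $(\Phi,\Psi)$ is the canonical pair given below. More precisely, one and only one of the following mutually exclusive situations occurs. (i) ($1$-Hermite case.) If $a=b=0$, one can take $\mathbf{v}=\bigl(\boldsymbol{\tau}_{e(d\mathfrak{c})^{-1}}\circ\boldsymbol{h}_{\mathfrak{c}^{-1}}\bigr)\mathbf{u}$, with $\Phi(x)=1$, $\Psi(x)=\alpha x$, where $\alpha=\frac{d}{c}\mathfrak{c}^2$; the canonical parameter satisfies $\alpha\neq 0$ and $-\frac{4}{\alpha}\notin\mathbb{N}^{\times}$. (ii) ($1$-Laguerre case.) If $a=0$ and $b\neq 0$, one can take $\mathbf{v}=\bigl(\boldsymbol{\tau}_{c(b\mathfrak{c})^{-1}}\circ\boldsymbol{h}_{\mathfrak{c}^{-1}}\bigr)\mathbf{u}$,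 with $\Phi(x)=x$, $\Psi(x)=\alpha x+\beta$, where $\alpha=\frac{d}{b}\mathfrak{c}$ and $\beta=\frac{be-dc}{b^2}$; the canonical parameters satisfy $\alpha\neq 0$ and $\beta\neq\frac14 n(\alpha^2-4)$ for all $n\in\mathbb{N}$. (iii) ($1$-Bessel case.) If $a\neq 0$ and $b^2-4ac=0$, one can take $\mathbf{v}=\bigl(\boldsymbol{\tau}_{b(2a\mathfrak{c})^{-1}}\circ\boldsymbol{h}_{\mathfrak{c}^{-1}}\bigr)\mathbf{u}$, with $\Phi(x)=x^2$, $\Psi(x)=\alpha x+\beta$, where $\alpha=\frac{d}{a}$ and $\beta=\frac{2ae-bd}{2a^2\mathfrak{c}}$; the canonical parameters satisfy $-\alpha\notin\mathbb{N}$ and $\beta^2\neq-\frac14 n(n+\alpha)(2n+\alpha)^2$ for all $n\in\mathbb{N}$. (iv) ($1$-Jacobi case.) If $a\neq 0$ and $b^2-4ac\neq 0$, one can take $\mathbf{v}=\bigl(\boldsymbol{\tau}_{b(2a\mathfrak{c})^{-1}}\circ\boldsymbol{h}_{\mathfrak{c}^{-1}}\bigr)\mathbf{u}$, with $\Phi(x)=x^2-\gamma$, $\Psi(x)=\alpha x+\beta$, where $\alpha=\frac{d}{a}$, $\beta=\frac{2ae-bd}{2a^2\mathfrak{c}}$ and $\gamma=\frac{b^2-4ac}{4a^2\mathfrak{c}^2}$; the canonical parameters satisfy $\gamma\neq 0$, $-\alpha\notin\mathbb{N}$ and $\beta^2\neq\frac14\bigl(4\gamma-n(n+\alpha)\bigr)(2n+\alpha)^2$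 for all $n\in\mathbb{N}$.
   Context: Notation: $\mathbb{N}=\{0,1,2,\dots\}$, $\mathbb{N}^{\times}=\{1,2,\dots\}$, $\mathbb{C}^{\times}=\mathbb{C}\setminus\{0\}$. The scalar $\mathfrak{c}$ (lattice slope) is distinct from the coefficient $c$ of $\phi$. $\mathcal{P}=\mathbb{C}[x]$ is the space of complex polynomials, with the strict inductive limit topology of the finite-dimensional spaces $\mathcal{P}_n$ of polynomials of degree at most $n$; $\mathcal{P}'$ is its continuous dual (every linear functional on $\mathcal{P}$ is continuous), with pairing $\langle\cdot,\cdot\rangle$. For $p\in\mathcal{P}$, $\mathbf{u}\in\mathcal{P}'$, the product $p\mathbf{u}\in\mathcal{P}'$ is defined by $\langle p\mathbf{u},q\rangle=\langle\mathbf{u},pq\rangle$ for $q\in\mathcal{P}$. For $\beta\in\mathbb{C}$ and $\alpha\in\mathbb{C}^{\times}$, the operators $\boldsymbol{\tau}_\beta,\boldsymbol{h}_\alpha:\mathcal{P}'\to\mathcal{P}'$ are defined by $\langle\boldsymbol{\tau}_\beta\mathbf{u},p\rangle=\langle\mathbf{u},p(\cdot+\beta)\rangle$ and $\langle\boldsymbol{h}_\alpha\mathbf{u},p\rangle=\langle\mathbf{u},p(\alpha\,\cdot)\rangle$, $p\in\mathcal{P}$. Composition is the usual composition of maps on $\mathcal{P}'$: $(\boldsymbol{\tau}_\beta\circ\boldsymbol{h}_\alpha)\mathbf{u}=\boldsymbol{\tau}_\beta(\boldsymbol{h}_\alpha\mathbf{u})$. Equivalence: $\mathbf{u}\sim^{*}\mathbf{v}$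 means that there exist $\beta\in\mathbb{C}$ and $\alpha\in\mathbb{C}^{\times}$ with $\mathbf{v}=(\boldsymbol{\tau}_\beta\circ\boldsymbol{h}_{\alpha^{-1}})\mathbf{u}$ (this is an equivalence relation on $\mathcal{P}'$). For a linear lattice $X(s)=\mathfrak{c}s+\mathfrak{d}$, $\mathfrak{c}\neq 0$, define on $\mathcal{P}$ $$(\mathrm{D}_Xp)(x)=\frac{p(x+\mathfrak{c}/2)-p(x-\mathfrak{c}/2)}{\mathfrak{c}},\qquad(\mathrm{S}_Xp)(x)=\frac{p(x+\mathfrak{c}/2)+p(x-\mathfrak{c}/2)}{2},$$ and on $\mathcal{P}'$, $\langle\boldsymbol{\mathrm{D}}_X\mathbf{u},p\rangle=-\langle\mathbf{u},\mathrm{D}_Xp\rangle$ and $\langle\boldsymbol{\mathrm{S}}_X\mathbf{u},p\rangle=\langle\mathbf{u},\mathrm{S}_Xp\rangle$ for $p\in\mathcal{P}$. A functional $\mathbf{u}\in\mathcal{P}'$ is regular (quasi-definite) if all Hankel determinants $\det\bigl(\langle\mathbf{u},x^{j+k}\rangle\bigr)_{j,k=0}^{n}$, $n\in\mathbb{N}$, are nonzero; equivalently, there is a sequence of polynomials $(p_n)_{n\ge0}$ with $\deg p_n=n$, $\langle\mathbf{u},p_np_m\rangle=0$ for $n\neq m$ and $\langle\mathbf{u},p_n^2\rangle\neq 0$ for all $n$. *)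

(* Defs.v *)
From HB Require Import structures.
From mathcomp Require Import all_boot all_order all_algebra.
From mathcomp Require Import reals complex ring.

Set Implicit Arguments.
Unset Strict Implicit.
Unset Printing Implicit Defensive.

Import Order.TTheory GRing.Theory Num.Theory.
Local Open Scope ring_scope.

(* Every linear functional on the polynomials is continuous for the strict
   inductive limit topology, so the continuous dual is the algebraic one.
   Functionals are compared pointwise, with [=1]. *)
Notation dual F := {scalar {poly F}}.

Section Polynomials.
Variable F : numFieldType.
Implicit Types (p q : {poly F}) (al be : F).

(* p(x + be) and p(al x) *)
Definition translate be p : {poly F} := p \Po ('X + be%:P).
Definition dilate al p : {poly F} := p \Po (al *: 'X).

Lemma translate_is_linear be : linear (translate be).
Proof. by move=> k p q; rewrite /translate linearP. Qed.
HB.instance Definition _ be :=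
  GRing.isLinear.Build F {poly F} {poly F} _ (translate be)
    (translate_is_linear be).

Lemma dilate_is_linear al : linear (dilate al).
Proof. by move=> k p q; rewrite /dilate linearP. Qed.
HB.instance Definition _ al :=
  GRing.isLinear.Build F {poly F} {poly F} _ (dilate al)
    (dilate_is_linear al).

(* X(s) = slope * s + offset.  It is a lattice when the slope is nonzero,
   which is a separate hypothesis. *)
Record linear_lattice := LinearLattice { slope : F; offset : F }.
Definition lattice_fun (X : linear_lattice) (s : F) : F :=
  slope X * s + offset X.
Coercion lattice_fun : linear_lattice >-> Funclass.

Definition X0 : linear_lattice := LinearLattice 1 0.

Implicit Type X : linear_lattice.

Definition polyD X p : {poly F} :=
  (slope X)^-1 *: (translate (slope X / 2) p - translate (- (slope X / 2)) p).
Definition polyS X p : {poly F} :=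
  2^-1 *: (translate (slope X / 2) p + translate (- (slope X / 2)) p).

Lemma polyD_is_linear X : linear (polyD X).
Proof.
move=> k p q; rewrite /polyD !linearP /= scalerA [k * _]mulrC -scalerA.
by rewrite -scalerDr [k *: (_ - _)]scalerDr addrACA.
Qed.
HB.instance Definition _ X :=
  GRing.isLinear.Build F {poly F} {poly F} _ (polyD X) (polyD_is_linear X).

Lemma polyS_is_linear X : linear (polyS X).
Proof.
move=> k p q; rewrite /polyS !linearP /= scalerA [k * _]mulrC -scalerA.
by rewrite -scalerDr [k *: (_ + _)]scalerDr addrACA.
Qed.
HB.instance Definition _ X :=
  GRing.isLinear.Build F {poly F} {poly F} _ (polyS X) (polyS_is_linear X).

Lemma polyD_lattice X p s :
  (polyD X p).[X s] =
    (p.[X (s + 2^-1)] - p.[X (s - 2^-1)]) / (X (s + 2^-1) - X (s - 2^-1)).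
Proof.
rewrite /polyD /translate /lattice_fun !hornerE !horner_comp !hornerE.
by rewrite mulrC; congr ((_.[_] - _.[_]) / _); field.
Qed.

Lemma polyS_lattice X p s :
  (polyS X p).[X s] = (p.[X (s + 2^-1)] + p.[X (s - 2^-1)]) / 2.
Proof.
rewrite /polyS /translate /lattice_fun !hornerE !horner_comp !hornerE.
by rewrite mulrC; congr ((_.[_] + _.[_]) / _); field.
Qed.

End Polynomials.

Section Functionals.
Variable F : numFieldType.
Implicit Types (p q : {poly F}) (al be : F) (u v : dual F).
Implicit Type X : linear_lattice F.

(* <p u, q> = <u, p q> *)
Definition mulf_fun p u q : F := u (p * q).
Lemma mulf_is_scalar p u : scalar (mulf_fun p u).
Proof.
by move=> k q r; rewrite /mulf_fun mulrDr -scalerAr linearP.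
Qed.
HB.instance Definition _ p u :=
  GRing.isLinear.Build F {poly F} F _ (mulf_fun p u) (mulf_is_scalar p u).
Definition mulf p u : dual F := mulf_fun p u.

Definition tau_op be u : dual F := u \o translate be.
Definition h_op al u : dual F := u \o dilate al.

Definition bD_fun X u p : F := - u (polyD X p).
Lemma bD_is_scalar X u : scalar (bD_fun X u).
Proof. by move=> k p q; rewrite /bD_fun !linearP opprD mulrN. Qed.
HB.instance Definition _ X u :=
  GRing.isLinear.Build F {poly F} F _ (bD_fun X u) (bD_is_scalar X u).
Definition bD X u : dual F := bD_fun X u.

Definition bS X u : dual F := u \o polyS X.

Definition dual_equiv u v : Prop :=
  exists be al : F, al != 0 /\ v =1 tau_op be (h_op al^-1 u).

Definition regular u : Prop :=
  forall n : nat, \det (\matrix_(j < n.+1, k < n.+1) u 'X^(j + k)) != 0.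

Definition pearson X (phi psi : {poly F}) u : Prop :=
  bD X (mulf phi u) =1 bS X (mulf psi u).

Definition hermite_param al : Prop :=
  al != 0 /\ forall n : nat, (0 < n)%N -> - (4 / al) != n%:R.

Definition laguerre_param al be : Prop :=
  al != 0 /\ forall n : nat, be != 4^-1 * n%:R * (al ^+ 2 - 4).

Definition bessel_param al be : Prop :=
  (forall n : nat, - al != n%:R) /\
  forall n : nat,
    be ^+ 2 != - (4^-1 * n%:R * (n%:R + al) * (2 * n%:R + al) ^+ 2).

Definition jacobi_param al be ga : Prop :=
  [/\ ga != 0, forall n : nat, - al != n%:R
    & forall n : nat,
        be ^+ 2 !=
          4^-1 * (4 * ga - n%:R * (n%:R + al)) * (2 * n%:R + al) ^+ 2].

Inductive canonical_pair : {poly F} -> {poly F} -> Prop :=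
| HermitePair al of hermite_param al :
    canonical_pair 1 (al *: 'X)
| LaguerrePair al be of laguerre_param al be :
    canonical_pair 'X (al *: 'X + be%:P)
| BesselPair al be of bessel_param al be :
    canonical_pair 'X^2 (al *: 'X + be%:P)
| JacobiPair al be ga of jacobi_param al be ga :
    canonical_pair ('X^2 - ga%:P) (al *: 'X + be%:P).

End Functionals.

Arguments X0 {F}.

Definition exactly_one (P1 P2 P3 P4 : Prop) : Prop :=
  [\/ [/\ P1, ~ P2, ~ P3 & ~ P4],
      [/\ ~ P1, P2, ~ P3 & ~ P4],
      [/\ ~ P1, ~ P2, P3 & ~ P4]
    | [/\ ~ P1, ~ P2, ~ P3 & P4]].

(* Main.v *)
Require Import Defs.
From HB Require Import structures.
From mathcomp Require Import all_boot all_order all_algebra.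
From mathcomp Require Import reals complex ring.

Set Implicit Arguments.
Unset Strict Implicit.
Unset Printing Implicit Defensive.

Import Order.TTheory GRing.Theory Num.Theory Defs.
Local Open Scope ring_scope.

(** The functional [v], obtained from [u] by an affine change of variable,
    solves the Pearson equation on the lattice of step 1 whose coefficients are [phi]
    and [psi] in the new variable, up to nonzero scalars; the three
    substitutions make the new [phi] equal to 1, ['X] or ['X^2 - ga].  This is
    [pearson_normalize], and regularity survives because it says that the
    bilinear form (p, q) |-> u (p q) is nondegenerate on the polynomials of
    degree at most n, for each n ([regularP]).  What remains is to extract the
    conditions on the parameters from the regularity of [v].

    With A = phi + psi/2 and B = phi - psi/2, the symmetric Pearson equation of
    step 1 is the one-sided relation v (A p) = v (B p(x - 1)).  It is inherited:
    A v satisfies the same relation for the pair (A(x + 1), B).  Moreover, the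
    forward difference, from v to A v, has, up to sign, the adjoint
    q |-> A q - B q(x - 1), the operator [raise], which raises the degree by one
    and multiplies the leading coefficient of a polynomial of degree n by
    d + n a.  Two consequences follow.

    - The operator [raise] after the forward difference is symmetric for v and
      has eigenvalue (n + 1)(d + n a) on the orthogonal polynomial of degree
      n + 1.  Were this zero, A v would vanish on the multiples of a nonzero
      polynomial, which regularity forbids as A is nonzero.  So d + n a is never
      zero ([raise_leading_neq0]).
    - Iterating [raise] from the constant 1 gives a Rodrigues formula for a
      polynomial of degree exactly n which is orthogonal to all smaller degrees,
      and whose pairing with x^n is, up to a nonzero factor, the mass v_n (1) of
      v_n = A(x) A(x + 1) ... A(x + n - 1) v.  Hence all these masses are
      nonzero ([shifted_weight_neq0]).  The mass of v_(n + 1) is v_n (A(x + n)), and the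
      Pearson relation of v_n determines its first two moments from its mass;
      the result is a nonzero multiple of the resultant of A(x + n) and
      A(x + n) - B ([pearson_resultant_neq0]).

    Expanding that resultant gives [regular_pearson_admissible], whose
    conditions specialize to those of the four canonical families. *)

(** * Translations and forward differences *)

Section Translations.
Variable F : numFieldType.
Implicit Types (p q : {poly F}) (al be : F).

Lemma translateC be (k : F) : translate be k%:P = k%:P.
Proof. by rewrite /translate comp_polyC. Qed.

Lemma translateX be : translate be ('X : {poly F}) = 'X + be%:P.
Proof. by rewrite /translate comp_polyX. Qed.

Lemma translateM be p q :
  translate be (p * q) = translate be p * translate be q.
Proof. exact: comp_polyM. Qed.

Lemma translate_add al be p :
  translate al (translate be p) = translate (al + be) p.
Proof.
rewrite /translate -comp_polyA; congr (_ \Po _).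
by rewrite comp_polyD comp_polyX comp_polyC -addrA -polyCD.
Qed.

Lemma translate0 p : translate 0 p = p.
Proof. by rewrite /translate addr0 comp_polyXr. Qed.

Lemma translateK be : cancel (translate be) (translate (- be) : {poly F} -> _).
Proof. by move=> p; rewrite translate_add addNr translate0. Qed.

Lemma translateVK be : cancel (translate (- be)) (translate be : {poly F} -> _).
Proof. by move=> p; rewrite translate_add subrr translate0. Qed.

Lemma size_translate be p : size (translate be p) = size p.
Proof. by rewrite size_comp_poly2 // size_XaddC. Qed.

(** Differences lower the degree, with a known leading coefficient. The bound
    is on the size, so that the coefficient formula also covers lower degrees.
    *)
Lemma size_translate_sub be m p : (size p <= m.+2)%N ->
  (size (translate be p - p)%R <= m.+1)%N /\
  (translate be p - p)`_m = be * p`_m.+1 * m.+1%:R.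
Proof.
elim: m p => [|m IHm] p szp.
  have -> : translate be p - p = (be * p`_1)%:P.
    have {1 2}-> : p = p`_1 *: 'X + (p`_0)%:P.
      apply/polyP => -[|[|i]]; rewrite !coefE /= ?mulr0 ?mulr1 ?add0r ?addr0 //.
      by rewrite nth_default // (leq_trans szp).
    rewrite linearD linearZ /= translateX translateC -!mul_polyC polyCM.
    by ring.
  by rewrite size_polyC leq_b1 coefC mulr1.
elim/poly_ind: p szp => [|q k _] szp.
  by rewrite linear0 subr0 size_poly0 !coef0 mulr0 mul0r.
have szq : (size q <= m.+2)%N.
  apply/leq_sizeP => i im; have /leq_sizeP/(_ i.+1 im) := szp.
  by rewrite coefD coefMX coefC /= addr0.
have [sz1 c1] := IHm q szq.
have -> : translate be (q * 'X + k%:P) - (q * 'X + k%:P) =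
    (translate be q - q) * 'X + be *: translate be q.
  rewrite linearD /= translateM translateX translateC -mul_polyC; ring.
split.
  apply: leq_trans (size_polyD _ _) _; rewrite geq_max; apply/andP; split.
    apply: leq_trans (size_polyMleq _ _) _.
    by rewrite size_polyX addn2.
  by rewrite (leq_trans (size_scale_leq _ _)) // size_translate.
rewrite coefD coefMX coefZ /= c1 coefD coefMX coefC /= addr0.
have -> : (translate be q)`_m.+1 = q`_m.+1.
  apply/eqP; rewrite -subr_eq0 -coefB; apply/eqP.
  by move/leq_sizeP: sz1; apply.
by rewrite -[m.+2]addn1 natrD; ring.
Qed.

Lemma coefM_top m n p q : (size p <= m.+1)%N -> (size q <= n.+1)%N ->
  (p * q)`_(m + n) = p`_m * q`_n.
Proof.
move=> /leq_sizeP szp /leq_sizeP szq; have mn : (m < (m + n).+1)%N.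
  by rewrite ltnS leq_addr.
rewrite coefM (bigD1 (Ordinal mn)) //= addKn big1 ?addr0 // => i /eqP neim.
have [lt_im|le_mi] := ltnP i m.
  by rewrite szq ?mulr0 // ltn_subRL ltn_add2r.
rewrite szp ?mul0r // ltn_neqAle le_mi andbT; apply/eqP => eq_mi.
by apply: neim; apply: val_inj.
Qed.

Definition fwd_diff p : {poly F} := translate 1 p - p.

Lemma fwd_diff_linear : linear fwd_diff.
Proof.
by move=> k p q; rewrite /fwd_diff linearP opprD addrACA scalerBr.
Qed.
HB.instance Definition _ :=
  GRing.isLinear.Build F {poly F} {poly F} _ fwd_diff fwd_diff_linear.

Lemma size_fwd_diff n p : (size p <= n.+1)%N -> (size (fwd_diff p) <= n)%N.
Proof.
case: n => [/size1_polyC->|n /(size_translate_sub 1)[] //].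
by rewrite /fwd_diff translateC subrr size_poly0.
Qed.

Lemma fwd_diff_neq0 n p : size p = n.+2 -> fwd_diff p != 0.
Proof.
move=> szp; apply: contraTneq isT => d0.
have [_] := size_translate_sub 1 (eq_leq szp).
rewrite -/(fwd_diff p) d0 coef0 mul1r => /esym/eqP.
rewrite mulf_eq0 pnatr_eq0 orbF.
have -> : p`_n.+1 = lead_coef p by rewrite lead_coefE szp.
by rewrite lead_coef_eq0 -size_poly_eq0 szp.
Qed.

Lemma fwd_diff_surj q : exists p, fwd_diff p = q.
Proof.
have [n] := ubnP (size q); elim: n q => // n IHn q; rewrite ltnS => szq.
case: n IHn szq => [|n] IHn szq.
  exists 0; rewrite linear0; apply/esym/eqP.
  by rewrite -size_poly_eq0 -leqn0.
(* r is chosen so that its difference has the same top coefficient as q *)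
pose r := (q`_n / n.+1%:R) *: 'X^(n.+1).
have szr : (size r <= n.+2)%N.
  by rewrite (leq_trans (size_scale_leq _ _)) // size_polyXn.
have [szd cd] := size_translate_sub 1 szr.
have [|p defp] := IHn (q - fwd_diff r).
  rewrite ltnS; apply/leq_sizeP => i; rewrite leq_eqVlt => /predU1P[<-|lt_ni].
    rewrite coefB /fwd_diff cd /r coefZ coefXn eqxx mulr1 mul1r divfK ?subrr //.
    by rewrite pnatr_eq0.
  rewrite nth_default // (leq_trans (size_polyD _ _)) // size_polyN geq_max.
  by rewrite (leq_trans szq) // (leq_trans szd).
by exists (p + r); rewrite linearD /= defp subrK.
Qed.

End Translations.

(** * Regularity as nondegeneracy *)

Section Regularity.
Variable F : numFieldType.
Implicit Types (p q : {poly F}) (u v : dual F).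

Lemma functional_rVpoly u n (x : 'rV[F]_n) (k : nat) :
  u (rVpoly x * 'X^k) = \sum_j x 0 j * u 'X^(j + k).
Proof.
rewrite (row_sum_delta x) linear_sum mulr_suml linear_sum.
apply: eq_bigr => j _.
rewrite linearZ /= rVpoly_delta -scalerAl -exprD linearZ /=.
by rewrite -row_sum_delta.
Qed.

Lemma functional_orth u n p q : (size q <= n)%N ->
  (forall k, (k < n)%N -> u (p * 'X^k) = 0) -> u (p * q) = 0.
Proof.
move=> szq orth; rewrite -[q]coefK poly_def mulr_sumr linear_sum big1 // => i _.
by rewrite -scalerAr linearZ /= orth ?mulr0 // (leq_trans (ltn_ord i)).
Qed.

(** A vector in the left kernel of the Hankel matrix of order n + 1 is the list
    of coefficients of a polynomial orthogonal to all degrees at most n. *)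
Lemma regularP u : regular u <->
  forall n p, (size p <= n.+1)%N ->
    (forall k, (k < n.+1)%N -> u (p * 'X^k) = 0) -> p = 0.
Proof.
split=> [ru n p szp orth|nondeg n].
  apply/eqP; rewrite -(poly_rV_K szp); apply: contraTT (ru n) => nz.
  rewrite negbK; apply/det0P; exists (poly_rV p).
    by apply: contraNneq nz => ->; rewrite linear0.
  apply/rowP => k; rewrite mxE [RHS]mxE -[RHS](orth k (ltn_ord k)).
  rewrite -[in RHS](poly_rV_K szp) functional_rVpoly.
  by apply: eq_bigr => j _; rewrite [in X in _ * X = _]mxE.
apply/det0P => -[x nzx xH]; case/eqP: nzx.
rewrite -[x]rVpolyK (nondeg n (rVpoly x)) ?linear0 ?size_poly // => k lt_kn.
pose H := \matrix_(j < n.+1, k < n.+1) u 'X^(j + k).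
rewrite functional_rVpoly; transitivity ((x *m H) 0 (Ordinal lt_kn)).
  by rewrite mxE; apply: eq_bigr => j _; rewrite [in RHS]mxE.
by rewrite xH mxE.
Qed.

(** The m + 1 coefficients of a polynomial of degree at most m are subject to
    only m orthogonality conditions; regularity then forces the degree to be m.
    *)
Lemma orthogonal_poly_exists u m : regular u ->
  exists2 P : {poly F}, size P = m.+1 &
    forall k, (k < m)%N -> u (P * 'X^k) = 0.
Proof.
move=> /regularP ru.
pose H := \matrix_(j < m.+1, k < m) u 'X^(j + k).
have nzK : kermx H != 0.
  by rewrite kermx_eq0 -row_leq_rank -ltnNge ltnS rank_leq_col.
pose x := nz_row (kermx H).
have xH : x *m H = 0 by apply/sub_kermxP; apply: nz_row_sub.
have orth k : (k < m)%N -> u (rVpoly x * 'X^k) = 0.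
  move=> lt_km; rewrite functional_rVpoly.
  transitivity ((x *m H) 0 (Ordinal lt_km)); last by rewrite xH mxE.
  by rewrite mxE; apply: eq_bigr => j _; rewrite [in RHS]mxE.
exists (rVpoly x) => //; apply/eqP; rewrite eqn_leq size_poly /= ltnNge.
have: rVpoly x != 0.
  apply: contra_neq (_ : x != 0); rewrite ?nz_row_eq0 // => x0.
  by rewrite -[x]rVpolyK x0 linear0.
apply: contraNN => sz; apply/eqP.
move: (rVpoly x) orth sz => p.
case: m {nzK xH x H} => [_|m orth /ru]; last exact.
by rewrite leqn0 size_poly_eq0 => /eqP.
Qed.

End Regularity.

(** * The one-sided Pearson relation *)

Section DifferencePearson.
Variable F : numFieldType.
Implicit Types (A B p q : {poly F}) (u v : dual F) (a d : F).

Definition diff_pearson A B v : Prop :=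
  forall p, v (A * p) = v (B * translate (-1) p).

(** Testing the symmetric equation on p(x - 1/2) leaves only the arguments x
    and x - 1. *)
Lemma pearsonX0_diff phi psi v :
  pearson X0 phi psi v ->
  diff_pearson (phi + 2^-1 *: psi) (phi - 2^-1 *: psi) v.
Proof.
move=> pv p; have := pv (translate (- (1 / 2)) p).
rewrite /bD /= /bD_fun /= /mulf_fun /polyD /polyS [slope _]/=.
rewrite translateVK translate_add.
have -> : - (1 / 2) - 1 / 2 = - 1 :> F by field.
rewrite invr1 scale1r -scalerAr linearZ /= mulrBr mulrDr linearB linearD /=.
rewrite mulrDl mulrBl -!scalerAl linearD linearB !linearZ /= => h.
apply/eqP; rewrite -subr_eq0; apply/eqP.
by move/eqP: h; rewrite -subr_eq0 => /eqP h; rewrite -[RHS]oppr0 -h; ring.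
Qed.

(** A v can be evaluated in two ways, q |-> v (A q) and q |-> v (B q(x - 1));
    the second one turns A(x + 1) into A. *)
Lemma diff_pearson_step A B v :
  diff_pearson A B v -> diff_pearson (translate 1 A) B (mulf A v).
Proof.
move=> pv p; rewrite /mulf /= /mulf_fun pv translateM translateK.
by rewrite mulrCA.
Qed.

(** The functional A(x) A(x + 1) ... A(x + n - 1) v, which is the weight for
    which the n-th differences of the orthogonal polynomials of v are
    orthogonal. *)
Fixpoint shifted_weight A v n : dual F :=
  if n is m.+1 then mulf (translate m%:R A) (shifted_weight A v m) else v.

(** The factors can also be peeled off from the other end, in the order in
    which [rodrigues] is unfolded. *)
Lemma shifted_weightS A v n :
  shifted_weight A v n.+1 =1 shifted_weight (translate 1 A) (mulf A v) n.
Proof.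
elim: n => [|n IHn] p; first by rewrite /= /mulf_fun translate0.
rewrite -[RHS]/(shifted_weight (translate 1 A) (mulf A v) n
  (translate n%:R (translate 1 A) * p)).
by rewrite -IHn translate_add natr1.
Qed.

Lemma shifted_weight_pearson A B v n : diff_pearson A B v ->
  diff_pearson (translate n%:R A) B (shifted_weight A v n).
Proof.
move=> pv; elim: n => [|n IHn] /=; first by rewrite translate0.
by rewrite -natr1 addrC -translate_add; apply: diff_pearson_step.
Qed.

Definition raise A B q : {poly F} := A * q - B * translate (-1) q.

(** Summation by parts: the shifted half of the difference is moved from p to q
    by the Pearson relation. *)
Lemma raise_adjoint A B v p q : diff_pearson A B v ->
  v (p * raise A B q) = - mulf A v (fwd_diff p * q).
Proof.
move=> pv; rewrite /mulf /= /mulf_fun /raise /fwd_diff.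
rewrite mulrBl mulrBr mulrBr !linearB /= pv translateM translateK.
by rewrite opprB mulrCA; congr (_ - v _); rewrite mulrCA.
Qed.

Fixpoint rodrigues A B n : {poly F} :=
  if n is m.+1 then raise A B (rodrigues (translate 1 A) B m) else 1.

(** Repeated summation by parts. The right side depends on the n-th difference
    of p only, so [rodrigues A B n] is orthogonal to all degrees below n. *)
Lemma rodrigues_adjoint A B v n p : diff_pearson A B v ->
  v (p * rodrigues A B n) =
    (-1) ^+ n * shifted_weight A v n (iter n (@fwd_diff F) p).
Proof.
elim: n A v p => [|n IHn] A v p pv; first by rewrite mul1r mulr1.
rewrite shifted_weightS [rodrigues _ _ _]/= (raise_adjoint _ _ pv).
by rewrite (IHn _ _ _ (diff_pearson_step pv)) iterSr exprS mulN1r mulNr.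
Qed.

(** The data on which degrees depend: A and B have the same coefficient a of
    x^2, so A - B has degree at most one, with coefficient d of x. In terms of
    the Pearson pair, a and d are the leading coefficients of phi and psi. *)
Definition pearson_coefs a d A B : Prop :=
  [/\ (size A <= 3)%N, (size B <= 3)%N, A`_2 = a, B`_2 = a & A`_1 - B`_1 = d].

Lemma pearson_coefs_translate a d A B : pearson_coefs a d A B ->
  pearson_coefs a (d + 2 * a) (translate 1 A) B.
Proof.
move=> [szA szB A2 B2 AB]; split=> //; first by rewrite size_translate.
  have [szD _] := size_translate_sub 1 szA.
  by rewrite -[translate 1 A](subrK A) coefD A2 nth_default ?add0r.
have [_ cD] := size_translate_sub 1 szA.
by rewrite -[translate 1 A](subrK A) coefD cD A2 -AB; ring.
Qed.

(** Written as (A - B) q + B (q - q(x - 1)), the image of x^n has leading terms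
    d x^(n + 1) and n a x^(n + 1). *)
Lemma size_raise a d A B q n : pearson_coefs a d A B -> (size q <= n.+1)%N ->
  (size (raise A B q) <= n.+2)%N /\
  (raise A B q)`_n.+1 = (d + n%:R * a) * q`_n.
Proof.
move=> [szA szB A2 B2 AB] szq.
have szAB : (size (A - B)%R <= 2)%N.
  apply/leq_sizeP => -[|[|[|i]]] // _; rewrite coefB ?A2 ?B2 ?subrr //.
  by rewrite !nth_default ?subrr // (leq_trans szA, leq_trans szB).
have -> : raise A B q = (A - B) * q + B * (q - translate (-1) q).
  by rewrite /raise; ring.
have szAq : (size ((A - B) * q)%R <= n.+2)%N.
  by rewrite (leq_trans (size_polyMleq _ _)) // -subn1 leq_subLR add1n
    (leq_trans (leq_add szAB szq)).
have cAq : ((A - B) * q)`_n.+1 = d * q`_n.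
  by rewrite -add1n (@coefM_top _ 1 n) // coefB AB.
case: n szq szAq cAq => [|n] szq szAq cAq.
  rewrite (size1_polyC szq) translateC subrr mulr0 addr0 mul0r addr0.
  by rewrite -size1_polyC.
have [szT cT] := size_translate_sub (-1) szq.
have szT' : (size (q - translate (-1) q)%R <= n.+1)%N.
  by rewrite -size_polyN opprB.
split.
  rewrite (leq_trans (size_polyD _ _)) // geq_max szAq /=.
  by rewrite (leq_trans (size_polyMleq _ _)) // -subn1 leq_subLR add1n
    (leq_trans (leq_add szB szT')).
rewrite coefD cAq -[in X in _ + X]add2n (@coefM_top _ 2 n) //.
by rewrite B2 -opprB coefN cT; ring.
Qed.

Lemma size_rodrigues a d A B n : pearson_coefs a d A B ->
  (forall m, d + m%:R * a != 0) ->
  (size (rodrigues A B n) <= n.+1)%N /\ (rodrigues A B n)`_n != 0.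
Proof.
elim: n a d A => [|n IHn] a d A cAB nzd.
  by rewrite size_poly1 coef1 oner_neq0.
have [|sz nz] := IHn _ _ _ (pearson_coefs_translate cAB).
  move=> m; have -> : d + 2 * a + m%:R * a = d + m.+2%:R * a.
    by rewrite -addn2 natrD; ring.
  exact: nzd.
have [sz' c'] := size_raise cAB sz.
by rewrite [rodrigues _ _ _]/= c' mulf_neq0.
Qed.

Lemma regular_mulf_eq0 A v : regular v -> (forall q, v (A * q) = 0) -> A = 0.
Proof.
by move=> /regularP ru vA; apply: (ru (size A)) => //; rewrite leqnSn.
Qed.

(** If d + n a = 0, the symmetric operator L sends the orthogonal polynomial P
    of degree n + 1 to a polynomial of degree at most n which is still
    orthogonal to all degrees at most n, hence to 0. By adjointness the
    functional A v then kills the multiples of the difference of P. *)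
Lemma raise_leading_neq0 a d A B v : regular v -> diff_pearson A B v ->
  pearson_coefs a d A B -> A != 0 -> forall n, d + n%:R * a != 0.
Proof.
move=> rv pv cAB nzA n; apply: contraNneq nzA => dn0.
have [P szP orthP] := orthogonal_poly_exists n.+1 rv.
pose L q := raise A B (fwd_diff q).
(* both sides are minus A v on the product of the two differences *)
have symL p q : v (p * L q) = v (q * L p).
  by rewrite /L !(raise_adjoint _ _ pv) [fwd_diff p * _]mulrC.
have szLP : (size (L P) <= n.+1)%N.
  have [sz c] := size_raise cAB (size_fwd_diff (eq_leq szP)).
  apply/leq_sizeP => i; rewrite leq_eqVlt => /predU1P[<-|lt_ni].
    by rewrite c dn0 mul0r.
  by rewrite nth_default // (leq_trans sz).
have LP0 : L P = 0.
  move/regularP: (rv) => /(_ n _ szLP); apply=> k lt_kn.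
  rewrite mulrC symL; apply: (functional_orth _ orthP).
  have szk : (size (fwd_diff ('X^k : {poly F})) <= k)%N.
    by apply: size_fwd_diff; rewrite size_polyXn.
  have [sz _] := size_raise cAB (leqW szk).
  case: k lt_kn szk sz => [|k] lt_kn szk sz.
    move: szk; rewrite leqn0 size_poly_eq0 /L => /eqP ->.
    by rewrite /raise linear0 !mulr0 subrr size_poly0.
  by have [sz' _] := size_raise cAB szk; rewrite (leq_trans sz').
have AP0 : A * fwd_diff P = 0.
  apply: (regular_mulf_eq0 rv) => q; have [p <-] := fwd_diff_surj q.
  have := raise_adjoint p (fwd_diff P) pv.
  rewrite -/(L P) LP0 mulr0 linear0 => /esym/eqP.
  by rewrite oppr_eq0 /mulf /= /mulf_fun mulrAC -mulrA => /eqP.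
by move/eqP: AP0; rewrite mulf_eq0 (negPf (fwd_diff_neq0 szP)) orbF => /eqP ->.
Qed.

(** On degrees at most n, the n-th difference is constant. If the n-th weight
    had mass zero, the Rodrigues polynomial would be orthogonal to its own
    degree as well, against regularity. *)
Lemma shifted_weight_neq0 a d A B v n : regular v -> diff_pearson A B v ->
  pearson_coefs a d A B -> (forall m, d + m%:R * a != 0) ->
  shifted_weight A v n 1 != 0.
Proof.
move=> rv pv cAB nzd; have [szR nzR] := size_rodrigues n cAB nzd.
apply: contraNneq nzR => w0; suff -> : rodrigues A B n = 0 by rewrite coef0.
move/regularP: rv => /(_ n _ szR); apply=> k lt_kn.
rewrite mulrC rodrigues_adjoint //.
have iter_size m p : (size p <= n.+1)%N -> (m <= n)%N ->
    (size (iter m (@fwd_diff F) p) <= (n - m).+1)%N.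
  move=> szp; elim: m => [|m IHm] lt_mn; first by rewrite subn0.
  by rewrite iterS size_fwd_diff // subnSK // IHm // ltnW.
have szk : (size ('X^k : {poly F}) <= n.+1)%N by rewrite size_polyXn.
have := iter_size n _ szk (leqnn n); rewrite subnn => /size1_polyC ->.
by rewrite -[_%:P]mulr1 mul_polyC linearZ /= w0 !mulr0.
Qed.

(** Put D = a1 - b1 and E = a0 - b0. The Pearson relation tested on 1 and ['X]
    gives D w(x) = - E w(1) and (D + a) w(x^2) = - (E + b1) w(x) - b0 w(1),
    whence (D + a) D w(A) = (a E^2 - a1 E D + a0 D^2) w(1); the bracket is the
    resultant of A and A - B = D x + E. *)
Lemma pearson_resultant_neq0 A B (w : dual F) a a1 a0 b1 b0 :
  A = a *: 'X^2 + a1 *: 'X + a0%:P -> B = a *: 'X^2 + b1 *: 'X + b0%:P ->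
  diff_pearson A B w -> w A != 0 ->
  a1 - b1 != 0 -> a1 - b1 + a != 0 ->
  a * (a0 - b0) ^+ 2 - a1 * (a0 - b0) * (a1 - b1) + a0 * (a1 - b1) ^+ 2 != 0.
Proof.
move=> defA defB pw nzA nzd nzda; apply: contraNneq nzA => res0.
have p1 := pw 1; have pX := pw 'X.
have T1 : translate (-1) (1 : {poly F}) = 1 by rewrite -polyC1 translateC.
have eA p : A * p = a *: ('X^2 * p) + a1 *: ('X * p) + a0 *: p.
  by rewrite defA -!mul_polyC; ring.
have eB p : B * p = a *: ('X^2 * p) + b1 *: ('X * p) + b0 *: p.
  by rewrite defB -!mul_polyC; ring.
have e3 : B * translate (-1) 'X =
    a *: 'X^3 + (b1 - a) *: 'X^2 + (b0 - b1) *: 'X + (- b0) *: 1.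
  by rewrite translateX defB -!mul_polyC !(polyCB, polyCN, polyC1); ring.
move: p1 pX; rewrite T1 e3 !eA eB !mulr1 -!exprSr -expr2.
have -> : w A = a * w 'X^2 + a1 * w 'X + a0 * w 1.
  by rewrite -[A]mulr1 eA !mulr1 !linearD /= !linearZ.
rewrite !(linearD, linearB) /= !linearZ /=.
move: (w 'X^3) (w 'X^2) (w 'X) (w 1) => m3 m2 m1 m0 p1 pX.
have h1 : (a1 - b1) * m1 = - (a0 - b0) * m0.
  apply/eqP; rewrite -subr_eq0; apply/eqP.
  by move/eqP: p1; rewrite -subr_eq0 => /eqP <-; ring.
have h2 : (a1 - b1 + a) * m2 = - (a0 - b0 + b1) * m1 - b0 * m0.
  apply/eqP; rewrite -subr_eq0; apply/eqP.
  by move/eqP: pX; rewrite -subr_eq0 => /eqP <-; ring.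
apply/eqP; move: (mulf_neq0 (expf_neq0 2 nzd) nzda) => nz.
(* D^2 (D + a) clears the denominators of w 'X and w 'X^2 *)
apply: (mulfI nz); rewrite mulr0.
transitivity ((a1 - b1) * m0 *
  (a * (a0 - b0) ^+ 2 - a1 * (a0 - b0) * (a1 - b1) + a0 * (a1 - b1) ^+ 2));
  last by rewrite res0 mulr0.
transitivity ((a1 - b1) ^+ 2 * a * ((a1 - b1 + a) * m2)
  + (a1 - b1) ^+ 2 * (a1 - b1 + a) * (a1 * m1 + a0 * m0)); first by ring.
rewrite h2.
transitivity (- (a1 - b1) * a * (a0 - b0 + b1) * ((a1 - b1) * m1)
  - (a1 - b1) ^+ 2 * a * b0 * m0 + (a1 - b1) * (a1 - b1 + a) *
    (a1 * ((a1 - b1) * m1) + a0 * (a1 - b1) * m0)); first by ring.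
by rewrite h1; ring.
Qed.

(** The first condition says that x^n is raised to degree n + 1. The second one
    is the resultant of [pearson_resultant_neq0] for A(x + n) and B, expanded
    in ep = E - n D / 2 with E the constant coefficient of A(x + n) - B. When D
    <> 0 it says that phi (- ep / D) + n (d + n a) / 4 <> 0. *)
Theorem regular_pearson_admissible (v : dual F) a b c d e :
  regular v ->
  pearson X0 (a *: 'X^2 + b *: 'X + c%:P) (d *: 'X + e%:P) v ->
  a *: 'X^2 + b *: 'X + c%:P != 0 ->
  (forall n, d + n%:R * a != 0) /\
  (forall n, let ep := n%:R * b + e in let D := d + (2 * n)%:R * a in
     a * ep ^+ 2 - b * ep * D +
       (c + 4^-1 * n%:R * (d + n%:R * a)) * D ^+ 2 != 0).
Proof.
move=> rv /pearsonX0_diff; set A := _ + _; set B := _ - _ => pv nzphi.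
have defA : A = a *: 'X^2 + (b + d / 2) *: 'X + (c + e / 2)%:P.
  by rewrite /A -!mul_polyC !(polyCD, polyCM); ring.
have defB : B = a *: 'X^2 + (b - d / 2) *: 'X + (c - e / 2)%:P.
  by rewrite /B -!mul_polyC !(polyCD, polyCM, polyCN); ring.
have coef_quad (x y z : F) : let q := x *: 'X^2 + y *: 'X + z%:P in
    [/\ (size q <= 3)%N, q`_2 = x & q`_1 = y].
  split; last 2 first.
  - by rewrite !coefE /= mulr1 mulr0 !addr0.
  - by rewrite !coefE /= mulr1 mulr0 add0r addr0.
  by apply/leq_sizeP => -[|[|[|i]]] // _; rewrite !coefE /= !mulr0 !addr0.
have cAB : pearson_coefs a d A B.
  have [szA A2 A1] := coef_quad a (b + d / 2) (c + e / 2).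
  have [szB B2 B1] := coef_quad a (b - d / 2) (c - e / 2).
  by rewrite defA defB; split=> //; rewrite A1 B1; field.
have nzA : A != 0.
  apply: contra_neq nzphi => A0.
  have B0 : B = 0.
    apply: (regular_mulf_eq0 rv) => q; have := pv (translate 1 q).
    by rewrite translateK => <-; rewrite A0 mul0r linear0.
  have -> : a *: 'X^2 + b *: 'X + c%:P = 2^-1 *: (A + B).
    rewrite /A /B addrACA addrN addr0 -mulr2n -scaler_nat scalerA.
    by rewrite mulVf ?scale1r // pnatr_eq0.
  by rewrite A0 B0 addr0 scaler0.
have nzd := raise_leading_neq0 rv pv cAB nzA.
split=> // n /=; set D := d + (2 * n)%:R * a.
have defAn : translate n%:R A = a *: 'X^2 + (b + d / 2 + (2 * n)%:R * a) *: 'X +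
     (c + e / 2 + n%:R * (b + d / 2) + n%:R ^+ 2 * a)%:P.
  rewrite defA !linearD !linearZ /= expr2 translateM translateX translateC natrM.
  by rewrite -!mul_polyC !(polyCD, polyCM, polyC_exp); ring.
have nzw : shifted_weight A v n (translate n%:R A) != 0.
  have := shifted_weight_neq0 n.+1 rv pv cAB nzd.
  by rewrite /= /mulf_fun mulr1.
have := pearson_resultant_neq0 defAn defB (shifted_weight_pearson n pv) nzw.
have -> : b + d / 2 + (2 * n)%:R * a - (b - d / 2) = D by rewrite /D; field.
move=> /(_ (nzd _)) nz.
have {nz}/nz : D + a != 0.
  by have := nzd (2 * n).+1; rewrite -natr1 mulrDl mul1r addrA.
by apply: contra_neq => <-; rewrite /D natrM; field.
Qed.

End DifferencePearson.

(** * Affine changes of variable *)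

Section AffineTransport.
Variable F : numFieldType.
Implicit Types (p q phi psi : {poly F}) (u v : dual F) (al be : F).

Lemma tau_hE be al u p :
  tau_op be (h_op al u) p = u (p \Po (al *: 'X + be%:P)).
Proof.
rewrite /= /dilate /translate -comp_polyA.
by rewrite comp_polyD comp_polyX comp_polyC.
Qed.

Lemma comp_affine p al be al' be' :
  (p \Po (al' *: 'X + be'%:P)) \Po (al *: 'X + be%:P) =
  p \Po ((al' * al) *: 'X + (al' * be + be')%:P).
Proof.
rewrite -comp_polyA comp_polyD comp_polyZ comp_polyX comp_polyC scalerDr.
by rewrite scalerA -addrA polyCD polyCM mul_polyC.
Qed.

Lemma comp_affineK al be : al != 0 ->
  cancel (fun p => p \Po (al *: 'X + be%:P))
         (fun p => p \Po (al^-1 *: 'X + (- (be / al))%:P)).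
Proof.
move=> nz p /=; rewrite comp_affine divff // scale1r.
by rewrite mulrN mulrC divfK // addNr addr0 comp_polyXr.
Qed.

Lemma regular_affine u al be : al != 0 -> regular u ->
  regular (tau_op be (h_op al u)).
Proof.
move=> nz /regularP ru; apply/regularP => n p szp orth.
have szaff (x y : F) q : x != 0 -> size (q \Po (x *: 'X + y%:P)) = size q.
  move=> nzx; apply: size_comp_poly2.
  rewrite size_polyDl ?size_scale ?size_polyX //.
  by rewrite (leq_ltn_trans (size_polyC_leq1 _)).
apply: (can_inj (comp_affineK be nz)); rewrite comp_poly0.
apply: (ru n) => [|k lt_kn]; first by rewrite szaff.
pose q := 'X^k \Po (al^-1 *: 'X + (- (be / al))%:P) : {poly F}.
have -> : 'X^k = q \Po (al *: 'X + be%:P).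
  rewrite /q comp_affine mulVf // scale1r.
  by rewrite [be / al]mulrC subrr addr0 comp_polyXr.
rewrite -comp_polyM -tau_hE; apply: (functional_orth _ orth).
by rewrite szaff ?invr_eq0 // size_polyXn.
Qed.

Lemma dual_equiv_affine u al be : al != 0 ->
  dual_equiv (tau_op be (h_op al u)) u.
Proof.
move=> nz; exists (- (be / al)), al; split=> // p.
rewrite tau_hE tau_hE comp_affine mulVf // scale1r.
by rewrite [be / al]mulrC subrr addr0 comp_polyXr.
Qed.

(** Substituting x / slope + be turns the differences and means of step 1 into
    those of step [slope X]; the difference quotient gains a factor [slope X],
    which is why the scalars of [phi] and [psi] differ by it. *)
Lemma pearson_affine (X : linear_lattice F) u phi psi Phi Psi be k :
  slope X != 0 -> pearson X phi psi u ->
  Phi \Po ((slope X)^-1 *: 'X + be%:P) = (k / slope X) *: phi ->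
  Psi \Po ((slope X)^-1 *: 'X + be%:P) = k *: psi ->
  pearson X0 Phi Psi (tau_op be (h_op (slope X)^-1 u)).
Proof.
set s := slope X => nz pu defPhi defPsi p; pose w := s^-1 *: 'X + be%:P.
have tr h q : translate h q \Po w = translate (s * h) (q \Po w).
  rewrite /translate -!comp_polyA; congr (_ \Po _).
  rewrite /w !comp_polyD !comp_polyZ !comp_polyX !comp_polyC scalerDr.
  by rewrite -!mul_polyC -polyCM mulKf // addrAC.
have D0 q : polyD X0 q \Po w = s *: polyD X (q \Po w).
  rewrite /polyD /= invr1 scale1r comp_polyB !tr scalerA divff // scale1r.
  by rewrite mulrN mulrA mulr1.
have S0 q : polyS X0 q \Po w = polyS X (q \Po w).
  rewrite /polyS /= comp_polyZ comp_polyD !tr.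
  by rewrite mulrN mulrA mulr1.
have := pu (p \Po w); rewrite /bD /= /bD_fun /= /mulf_fun => e.
have tauw q : tau_op be (h_op s^-1 u) q = u (q \Po w) by rewrite tau_hE.
rewrite /bD /bS /mulf.
change (- tau_op be (h_op s^-1 u) (Phi * polyD X0 p)
        = tau_op be (h_op s^-1 u) (Psi * polyS X0 p)).
rewrite !tauw !comp_polyM defPhi defPsi D0 S0 -!scalerAl -scalerAr scalerA.
by rewrite divfK // !linearZ /= -mulrN e.
Qed.

Lemma pearson_normalize (X : linear_lattice F) u phi psi Phi Psi be k :
  slope X != 0 -> regular u -> pearson X phi psi u ->
  Phi \Po ((slope X)^-1 *: 'X + be%:P) = (k / slope X) *: phi ->
  Psi \Po ((slope X)^-1 *: 'X + be%:P) = k *: psi ->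
  let v := tau_op be (h_op (slope X)^-1 u) in
  [/\ regular v, dual_equiv v u & pearson X0 Phi Psi v].
Proof.
move=> nz ru pu ePhi ePsi; split.
- by apply: regular_affine => //; rewrite invr_eq0.
- by apply: dual_equiv_affine; rewrite invr_eq0.
- exact: (pearson_affine nz pu ePhi ePsi).
Qed.

End AffineTransport.

(** * The four canonical families *)

Section CanonicalForms.
Variable F : numFieldType.
Implicit Types (u v : dual F) (a b c d e al be ga : F).

Lemma quadratic_eq0 a b c :
  a *: 'X^2 + b *: 'X + c%:P = 0 :> {poly F} -> [/\ a = 0, b = 0 & c = 0].
Proof.
move=> /polyP q0; move: (q0 2) (q0 1%N) (q0 0); rewrite !coefE /=.
by rewrite !mulr1 !mulr0 !add0r !addr0.
Qed.

Lemma hermite_admissible v al :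
  regular v -> pearson X0 1 (al *: 'X) v -> hermite_param al.
Proof.
move=> rv pv; have [] := @regular_pearson_admissible F v 0 0 1 al 0 rv.
- by rewrite !scale0r !add0r addr0.
- by rewrite !scale0r !add0r polyC1 oner_neq0.
move=> nzd nzc; have nzal : al != 0 by have := nzd 0; rewrite mul0r addr0.
split=> // n _; have := nzc n; rewrite /= mulr0 !addr0.
apply: contra_neq => en; have nal : n%:R * al = -4 by rewrite -en; field.
by rewrite -[_ * n%:R * al]mulrA nal; field.
Qed.

Lemma laguerre_admissible v al be :
  regular v -> pearson X0 'X (al *: 'X + be%:P) v -> laguerre_param al be.
Proof.
move=> rv pv; have [] := @regular_pearson_admissible F v 0 1 0 al be rv.
- by rewrite scale0r scale1r add0r addr0.
- by rewrite scale0r scale1r add0r addr0 polyX_eq0.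
move=> nzd nzc; have nzal : al != 0 by have := nzd 0; rewrite mul0r addr0.
split=> // n; have := nzc n; rewrite /=.
by apply: contra_neq => ->; rewrite natrM; field.
Qed.

(** The Bessel and Jacobi families together: the conditions do not separate [ga
    = 0] from [ga != 0]. *)
Lemma quadratic_admissible v al be ga :
  regular v -> pearson X0 ('X^2 - ga%:P) (al *: 'X + be%:P) v ->
  (forall n : nat, - al != n%:R) /\
  forall n : nat, be ^+ 2 !=
    4^-1 * (4 * ga - n%:R * (n%:R + al)) * (2 * n%:R + al) ^+ 2.
Proof.
move=> rv pv; have [] := @regular_pearson_admissible F v 1 0 (- ga) al be rv.
- by rewrite scale0r scale1r addr0 polyCN.
- by apply/eqP => /quadratic_eq0[/eqP]; rewrite oner_eq0.
move=> nzd nzc; split=> n.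
  by have := nzd n; apply: contra_neq => <-; ring.
have := nzc n; rewrite /= natrM.
apply: contra_neq => eb.
have -> : 1 * (n%:R * 0 + be) ^+ 2 = be ^+ 2 by ring.
by rewrite eb; field.
Qed.

Lemma bessel_admissible v al be :
  regular v -> pearson X0 'X^2 (al *: 'X + be%:P) v -> bessel_param al be.
Proof.
move=> rv pv; have [] := @quadratic_admissible v al be 0 rv.
  by rewrite subr0.
move=> nzd nzc; split=> // n; have := nzc n; congr (_ != _).
by ring.
Qed.

(** For constant [phi] the normalization divides by c and d, so these have to
    be nonzero beforehand. If c = 0, then psi is orthogonal to 1 and x; if d =
    0, testing on 1 gives e = 0 and testing on x gives c = 0. *)
Lemma constant_phi_pearson_neq0 (X : linear_lattice F) u c d e :
  slope X != 0 -> regular u ->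
  ~ (c%:P = 0 :> {poly F} /\ d *: 'X + e%:P = 0 :> {poly F}) ->
  pearson X c%:P (d *: 'X + e%:P) u -> c != 0 /\ d != 0.
Proof.
move=> nz ru hne pu; have nzu : u 1 != 0.
  by have := ru 0; rewrite det_mx11 mxE expr0.
have pE p : - (c * u (polyD X p)) = u ((d *: 'X + e%:P) * polyS X p).
  have := pu p; rewrite /bD /= /bD_fun /= /mulf_fun => <-.
  by move: (polyD X p) => q; rewrite mul_polyC linearZ.
have half2 (p : {poly F}) : 2^-1 *: (p + p) = p.
  by rewrite -mulr2n -scaler_nat scalerA mulVf ?scale1r // pnatr_eq0.
have D1 : polyD X 1 = 0.
  by rewrite /polyD -polyC1 !translateC subrr scaler0.
have S1 : polyS X 1 = 1 by rewrite /polyS -polyC1 !translateC half2.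
have DX : polyD X 'X = 1.
  rewrite /polyD !translateX opprD addrACA subrr add0r -polyCN -polyCD opprK.
  by rewrite -splitr -mul_polyC -polyCM mulVf.
have SX : polyS X 'X = 'X.
  by rewrite /polyS !translateX addrACA -polyCD subrr addr0 half2.
have := pE 'X; have := pE 1; rewrite D1 S1 DX SX linear0 mulr0 oppr0 mulr1.
move=> psi1 psiX; split.
  apply: contra_notN hne => /eqP c0; split; first by rewrite c0.
  move/regularP: ru => /(_ 1%N); apply=> [|[|[|//]] _].
  - apply/leq_sizeP => -[|[|i]] // _.
    by rewrite !coefE /= mulr0 addr0.
  - by rewrite expr0 mulr1 -psi1.
  - by rewrite expr1 -psiX c0 mul0r oppr0.
apply: contra_notN hne => /eqP d0.
move: psi1 psiX; rewrite d0 scale0r add0r !mul_polyC -[e%:P]mulr1 mul_polyC.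
rewrite linearZ /= => /esym/eqP; rewrite mulf_eq0 (negPf nzu) orbF => /eqP ->.
rewrite !scale0r linear0 => /eqP.
by rewrite oppr_eq0 mulf_eq0 (negPf nzu) orbF => /eqP ->.
Qed.

Lemma comp_affine_linear (x y s be : F) :
  (x *: 'X + y%:P) \Po (s *: 'X + be%:P) = (x * s) *: 'X + (x * be + y)%:P.
Proof.
rewrite comp_polyD comp_polyZ comp_polyX comp_polyC.
by rewrite -!mul_polyC !(polyCD, polyCM); ring.
Qed.

Lemma scale_affine (k x y : F) :
  k *: (x *: 'X + y%:P) = (k * x) *: 'X + (k * y)%:P.
Proof. by rewrite scalerDr scalerA -[k *: y%:P]mul_polyC -polyCM. Qed.

Lemma hermite_reduction (X : linear_lattice F) u c d e :
  slope X != 0 -> regular u ->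
  ~ (c%:P = 0 :> {poly F} /\ d *: 'X + e%:P = 0 :> {poly F}) ->
  pearson X c%:P (d *: 'X + e%:P) u ->
  let v := tau_op (e * (d * slope X)^-1) (h_op (slope X)^-1 u) in
  let al := d / c * slope X ^+ 2 in
  [/\ regular v, dual_equiv v u, pearson X0 1 (al *: 'X) v
    & hermite_param al].
Proof.
move=> nz ru hne pu v al.
have [nzc nzd] := constant_phi_pearson_neq0 nz ru hne pu.
have [] := @pearson_normalize _ X u _ _ 1 (al *: 'X)
  (e * (d * slope X)^-1) (slope X / c) nz ru pu.
- rewrite -polyC1 comp_polyC -mul_polyC -polyCM; congr _%:P; field.
  by rewrite nz nzc.
- rewrite -[al *: 'X]addr0 -polyC0 comp_affine_linear addr0 scale_affine.
  by congr (_ *: _ + _%:P); rewrite /al; field; rewrite ?nz ?nzc ?nzd.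
by move=> rv eqv pv; split=> //; apply: hermite_admissible rv pv.
Qed.

Lemma laguerre_reduction (X : linear_lattice F) u b c d e :
  slope X != 0 -> regular u -> b != 0 ->
  pearson X (b *: 'X + c%:P) (d *: 'X + e%:P) u ->
  let v := tau_op (c * (b * slope X)^-1) (h_op (slope X)^-1 u) in
  let al := d / b * slope X in
  let be := (b * e - d * c) / b ^+ 2 in
  [/\ regular v, dual_equiv v u, pearson X0 'X (al *: 'X + be%:P) v
    & laguerre_param al be].
Proof.
move=> nz ru nzb pu v al be.
have [] := @pearson_normalize _ X u _ _ 'X (al *: 'X + be%:P)
  (c * (b * slope X)^-1) b^-1 nz ru pu.
- rewrite comp_polyX scale_affine.
  by congr (_ *: _ + _%:P); field; rewrite nz nzb.
- rewrite comp_affine_linear scale_affine.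
  by congr (_ *: _ + _%:P); rewrite /al /be; field; rewrite ?nz ?nzb.
by move=> rv eqv pv; split=> //; apply: laguerre_admissible rv pv.
Qed.

Lemma quadratic_reduction (X : linear_lattice F) u a b c d e :
  slope X != 0 -> regular u -> a != 0 ->
  pearson X (a *: 'X^2 + b *: 'X + c%:P) (d *: 'X + e%:P) u ->
  let v := tau_op (b * (2 * a * slope X)^-1) (h_op (slope X)^-1 u) in
  let al := d / a in
  let be := (2 * a * e - b * d) / (2 * a ^+ 2 * slope X) in
  let ga := (b ^+ 2 - 4 * a * c) / (4 * a ^+ 2 * slope X ^+ 2) in
  [/\ regular v, dual_equiv v u
    & pearson X0 ('X^2 - ga%:P) (al *: 'X + be%:P) v].
Proof.
move=> nz ru nza pu v al be ga.
apply: (@pearson_normalize _ X u _ _ _ _ _ (a * slope X)^-1 nz ru pu).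
- rewrite comp_polyB comp_polyC comp_Xn_poly -!mul_polyC.
  set y := b / _.
  transitivity (((slope X)^-1 ^+ 2)%:P * 'X^2
    + (2 * (slope X)^-1 * y)%:P * 'X + (y ^+ 2 - ga)%:P);
    first by rewrite !(polyCB, polyCM, polyC_exp); ring.
  have -> k : k%:P * (a%:P * 'X^2 + b%:P * 'X + c%:P) =
      (k * a)%:P * 'X^2 + (k * b)%:P * 'X + (k * c)%:P.
    by rewrite !polyCM; ring.
  congr (_%:P * _ + _%:P * _ + _%:P); rewrite /y /ga; field;
    by rewrite ?nz ?nza.
- rewrite comp_affine_linear scale_affine.
  by congr (_ *: _ + _%:P); rewrite /al /be; field; rewrite ?nz ?nza.
Qed.

End CanonicalForms.

Theorem theorem4p1 (R : realType) (X : linear_lattice R[i])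
    (hX : slope X != 0) (u : dual R[i]) (hu : regular u)
    (a b c d e : R[i])
    (hne : ~ (a *: 'X^2 + b *: 'X + c%:P = 0 /\ d *: 'X + e%:P = 0))
    (heq : pearson X (a *: 'X^2 + b *: 'X + c%:P) (d *: 'X + e%:P) u) :
  (exists (v : dual R[i]) (Phi Psi : {poly R[i]}),
     [/\ regular v, dual_equiv v u, canonical_pair Phi Psi
       & pearson X0 Phi Psi v]) /\
  exactly_one
    (* 1-Hermite *)
    ([/\ a = 0, b = 0 &
      let v := tau_op (e * (d * slope X)^-1) (h_op (slope X)^-1 u) in
      let al := d / c * slope X ^+ 2 in
      [/\ regular v, dual_equiv v u, pearson X0 1 (al *: 'X) v
        & hermite_param al]])
    (* 1-Laguerre *)
    ([/\ a = 0, b <> 0 &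
      let v := tau_op (c * (b * slope X)^-1) (h_op (slope X)^-1 u) in
      let al := d / b * slope X in
      let be := (b * e - d * c) / b ^+ 2 in
      [/\ regular v, dual_equiv v u, pearson X0 'X (al *: 'X + be%:P) v
        & laguerre_param al be]])
    (* 1-Bessel *)
    ([/\ a <> 0, b ^+ 2 - 4 * a * c = 0 &
      let v := tau_op (b * (2 * a * slope X)^-1) (h_op (slope X)^-1 u) in
      let al := d / a in
      let be := (2 * a * e - b * d) / (2 * a ^+ 2 * slope X) in
      [/\ regular v, dual_equiv v u, pearson X0 'X^2 (al *: 'X + be%:P) v
        & bessel_param al be]])
    (* 1-Jacobi *)
    ([/\ a <> 0, b ^+ 2 - 4 * a * c <> 0 &
      let v := tau_op (b * (2 * a * slope X)^-1) (h_op (slope X)^-1 u) in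
      let al := d / a in
      let be := (2 * a * e - b * d) / (2 * a ^+ 2 * slope X) in
      let ga := (b ^+ 2 - 4 * a * c) / (4 * a ^+ 2 * slope X ^+ 2) in
      [/\ regular v, dual_equiv v u,
          pearson X0 ('X^2 - ga%:P) (al *: 'X + be%:P) v
        & jacobi_param al be ga]]).

Proof.
case: (eqVneq a 0) => [a0|nza].
  rewrite a0 scale0r add0r in hne heq *.
  case: (eqVneq b 0) => [b0|nzb].
    rewrite b0 scale0r add0r in hne heq *.
    have red := hermite_reduction hX hu hne heq.
    split.
      have [rv ev pv adm] := red; do 3!eexists.
      split; [exact: rv|exact: ev| |exact: pv].
      exact: HermitePair.
    by constructor 1; split=> [|[_ []]|[]|[]].
  rewrite -?b0 in heq; have red := laguerre_reduction hX hu nzb heq.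
  split.
    have [rv ev pv adm] := red; do 3!eexists.
    split; [exact: rv|exact: ev| |exact: pv].
    exact: LaguerrePair.
  constructor 2; split=> [[_ /eqP]|||]; first by rewrite (negPf nzb).
  - by split=> //; apply/eqP.
  - by case.
  - by case.
have [rv ev pv] := quadratic_reduction hX hu nza heq.
have [al_n be_n] := quadratic_admissible rv pv.
case: (eqVneq (b ^+ 2 - 4 * a * c) 0) => [disc0|nzdisc].
  rewrite disc0 mul0r subr0 in pv be_n *.
  have adm := bessel_admissible rv pv; split.
    by do 3!eexists; split; [exact: rv|exact: ev| |exact: pv]; exact: BesselPair.
  constructor 3; split=> [[/eqP]|[/eqP]||[_ []] //]; rewrite ?(negPf nza) //.
  by split=> //; apply/eqP.
have nzga : (b ^+ 2 - 4 * a * c) / (4 * a ^+ 2 * slope X ^+ 2) != 0.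
  by rewrite mulf_neq0 // invr_neq0 // !mulf_neq0 ?expf_neq0 // pnatr_eq0.
have adm : jacobi_param (d / a) ((2 * a * e - b * d) / (2 * a ^+ 2 * slope X))
    ((b ^+ 2 - 4 * a * c) / (4 * a ^+ 2 * slope X ^+ 2)) by split.
split.
  by do 3!eexists; split; [exact: rv|exact: ev| |exact: pv]; exact: JacobiPair.
constructor 4; split=> [[/eqP]|[/eqP]|[_ /eqP]|];
  rewrite ?(negPf nza) ?(negPf nzdisc) //.
by split=> //; apply/eqP.
Qed.
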